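(* Let $G=(V,E)$ be an undirected graph with $n=|V|$ nodes and let $f$ be an integer with $0<f<n$. If there exists an algorithm that solves $\epsilon$-approximate Byzantine consensus on $G$ in the asynchronous local broadcast model tolerating at most $f$ Byzantine faulty nodes, then $G$ is $(2f+1)$-connected, i.e., $G$ has no vertex cut of size at most $2f$ (no set $C\subseteq V$ with $|C|\le 2f$ such that $G-C$ has two non-empty parts $A,B$ with no edge between $A$ and $B$).
   Context: Communication network: an undirected graph $G=(V,E)$ known to every node; each edge is a reliable FIFO link, and a receiver knows the identity of the sender of each message. Local broadcast model: every message sent by a node $u$ is received identically and correctly by all neighbors of $u$ (so a node cannot send different messages to different neighbors). Asynchrony: nodes proceed at arbitrary speeds with no global clock, and every message is delivered after an unbounded but finite delay. At most $f$ nodes are Byzantine faulty and may behave arbitrarily, subject to the local broadcast constraint (in particular a faulty node may crash, i.e. take no steps). $\epsilon$-approximate Byzantine consensus: there are known reals $L<U$ and $\epsilon$ with $U-L>\epsilon>0$; each node starts with a real input in $[L,U]$ and must output a real value such that (1) $\epsilon$-Agreement: the outputs of any two non-faulty nodes differ by at most $\epsilon$; (2) Validity: each non-faulty node's output lies in the convex hull of the inputs of the non-faulty nodes; (3) Termination: every non-faulty node decides its output within finite time (which may depend on $U$, $L$, $\epsilon$). Once a node terminates it takes no further steps. *)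

(* Defs.v *)
From HB Require Import structures.
From mathcomp Require Import all_boot.
From Stdlib Require Import Reals.

Set Implicit Arguments.
Unset Strict Implicit.
Unset Printing Implicit Defensive.

(* Graphs: an undirected simple graph is a symmetric irreflexive       *)
(* relation adj on a finite vertex type V.                             *)

Definition vertex_cut (V : finType) (adj : rel V) (C A B : {set V}) : Prop :=
  A != set0 /\ B != set0 /\
  [disjoint A & B] /\ [disjoint A & C] /\ [disjoint B & C] /\
  A :|: B :|: C = [set: V] /\
  (forall a b, a \in A -> b \in B -> ~~ adj a b).

Definition k_connected (V : finType) (adj : rel V) (k : nat) : Prop :=
  ~ exists C A B : {set V}, (#|C| < k)%N /\ vertex_cut adj C A B.

(* An algorithm (for a fixed, known graph) gives each node v:
   - init v x  : initial local state for input x, and the list of messages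
                 it broadcasts when it starts;
   - step v s u m : the new local state and the messages broadcast when
                 node v in state s receives message m from neighbour u
                 (the receiver knows the sender's identity);
   - decide v s : Some y once v has decided output y in state s. *)
Record algorithm (V : finType) := Algorithm {
  St : Type;
  Msg : Type;
  init : V -> R -> St * seq Msg;
  step : V -> St -> V -> Msg -> St * seq Msg;
  decide : V -> St -> option R }.
Arguments St {V} a.
Arguments Msg {V} a.
Arguments init {V} a _ _.
Arguments step {V} a _ _ _ _.
Arguments decide {V} a _ _.

Inductive event (V : finType) (M : Type) :=
  | EvStart of V
  | EvDeliver of V & V          (* deliver head of link (sender, receiver) *)
  | EvByz of V & M.

(* Global configuration: local states (None = not yet started) and the FIFO
   queue of each directed link (sender, receiver). *)
Record config (V : finType) (S M : Type) := Config {
  cstate : V -> option S;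
  cqueue : V -> V -> seq M }.

Definition init_config (V : finType) (S M : Type) : config V S M :=
  Config (fun _ => None) (fun _ _ => [::]).

Definition bcast (V : finType) (M : Type) (adj : rel V)
    (q : V -> V -> seq M) (u : V) (ms : seq M) : V -> V -> seq M :=
  fun a b => if (a == u) && adj u b then q a b ++ ms else q a b.

Definition upd (V : finType) (S : Type) (st : V -> option S) (v : V) (s : S) :=
  fun w => if w == v then Some s else st w.

Definition output (V : finType) (P : algorithm V)
    (c : config V (St P) (Msg P)) (v : V) : option R :=
  match cstate c v with Some s => decide P v s | None => None end.
Arguments output {V} P c v.

(* Effect of an event; events that are not enabled are no-ops.
   F is the set of Byzantine nodes, x the vector of inputs.
   Non-faulty nodes follow the algorithm and take no step once decided;
   faulty nodes may broadcast arbitrary messages at arbitrary times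
   (subject to local broadcast); a faulty node that never does so crashes. *)
Definition apply_event (V : finType) (P : algorithm V) (adj : rel V)
    (F : {set V}) (x : V -> R) (c : config V (St P) (Msg P))
    (e : event V (Msg P)) : config V (St P) (Msg P) :=
  match e with
  | EvStart v =>
      match cstate c v with
      | None =>
          if v \notin F then
            let (s, ms) := init P v (x v) in
            Config (upd (cstate c) v s) (bcast adj (cqueue c) v ms)
          else c
      | Some _ => c
      end
  | EvDeliver u v =>
      if (v \notin F) && adj u v then
        match cstate c v, cqueue c u v with
        | Some s, m :: q =>
            match decide P v s with
            | Some _ => c
            | None =>
                let (s', ms) := step P v s u m in
                let q' := fun a b => if (a == u) && (b == v) then q
                                     else cqueue c a b in
                Config (upd (cstate c) v s') (bcast adj q' v ms)
            end
        | _, _ => c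
        end
      else c
  | EvByz u m =>
      if u \in F then Config (cstate c) (bcast adj (cqueue c) u [:: m])
      else c
  end.
Arguments apply_event {V} P adj F x c e.

Fixpoint run (V : finType) (P : algorithm V) (adj : rel V) (F : {set V})
    (x : V -> R) (ev : nat -> event V (Msg P)) (k : nat)
    : config V (St P) (Msg P) :=
  match k with
  | 0 => init_config V (St P) (Msg P)
  | k'.+1 => apply_event P adj F x (run adj F x ev k') (ev k')
  end.
Arguments run {V} P adj F x ev k.

Definition fair (V : finType) (P : algorithm V) (adj : rel V) (F : {set V})
    (x : V -> R) (ev : nat -> event V (Msg P)) : Prop :=
  let c := run P adj F x ev in
  (forall v, v \notin F -> exists k, cstate (c k) v <> None) /\
  (forall u v k, v \notin F -> adj u v -> cqueue (c k) u v <> [::] ->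
     exists k', (k <= k')%N /\
       (output P (c k') v <> None \/
        (ev k' = EvDeliver (Msg P) u v /\ cstate (c k') v <> None /\
         cqueue (c k') u v <> [::]))).
Arguments fair {V} P adj F x ev.

Definition in_hull (V : finType) (F : {set V}) (x : V -> R) (y : R) : Prop :=
  exists lam : V -> R,
    [/\ forall v, (0 <= lam v)%R,
        forall v, v \in F -> lam v = 0%R,
        \big[Rplus/0%R]_(v : V) lam v = 1%R
      & y = \big[Rplus/0%R]_(v : V) (lam v * x v)%R].

Definition solves_approx_BC (V : finType) (adj : rel V) (f : nat)
    (L U eps : R) (P : algorithm V) : Prop :=
  forall (F : {set V}) (x : V -> R) (ev : nat -> event V (Msg P)),
    (#|F| <= f)%N ->
    (forall v, (L <= x v <= U)%R) ->
    fair P adj F x ev ->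
    let c := run P adj F x ev in
    [/\
        forall v, v \notin F -> exists k y, output P (c k) v = Some y,
        forall v w k k' y y', v \notin F -> w \notin F ->
          output P (c k) v = Some y -> output P (c k') w = Some y' ->
          (Rabs (y - y') <= eps)%R
      &
        forall v k y, v \notin F -> output P (c k) v = Some y ->
          in_hull F x y].

(* Main.v *)
(* Split the cut C into C1 and C2 with at most f nodes each, and run the
   algorithm with C1 crashed, inputs L on A and inputs U on B and C2. A node of
   A cannot distinguish this execution from one in which all inputs are L, the
   nodes of C1 are merely slow, and C2 is faulty and broadcasts exactly what it
   did before (pretending that B has input U); so it outputs L by validity.
   Exchanging the roles of A and B, a node of B outputs U, and agreement fails.
   Local broadcast does not help since the faulty nodes never equivocate. *)
Require Import Defs.
From HB Require Import structures.
From mathcomp Require Import all_boot.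
From Stdlib Require Import Reals Lra.

Set Implicit Arguments.
Unset Strict Implicit.
Unset Printing Implicit Defensive.

(** * Convex hulls and splitting a finite set *)

Lemma in_hull_const (V : finType) (F : {set V}) (z y : R) :
  in_hull F (fun _ => z) y -> y = z.
Proof.
case=> lam [_ _ lam1 ->].
suff -> : \big[Rplus/0%R]_(v : V) (lam v * z)%R
        = (\big[Rplus/0%R]_(v : V) lam v * z)%R by rewrite lam1; ring.
by elim/big_rec2: _ => [|v y1 y2 _ ->]; ring.
Qed.

Lemma split_card_leq (T : finType) (C : {set T}) (f : nat) :
  (#|C| <= 2 * f)%N ->
  exists D E : {set T},
    [/\ (#|D| <= f)%N, (#|E| <= f)%N, [disjoint D & E] & D :|: E = C].
Proof.
(* [take] keeps all of [C] when [f] exceeds its size, hence the [minn] below. *)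
move=> leC; pose D := [set x in take f (enum C)].
have sDC : D \subset C.
  by apply/subsetP=> x; rewrite inE => /mem_take; rewrite mem_enum.
have cD : #|D| = minn f #|C|.
  rewrite cardsE (card_uniqP (take_uniq _ (enum_uniq _))) size_take_min.
  by rewrite -cardE.
exists D, (C :\: D); split.
- by rewrite cD geq_minl.
- rewrite cardsD (setIidPr sDC) cD leq_subLR.
  by case: (leqP f #|C|) => [_|/ltnW lt]; rewrite ?addnn -?mul2n ?leq_addr.
- by rewrite disjoints_subset setCD subsetUr.
- by rewrite setDE setUIr (setUidPr sDC) setUCr setIT.
Qed.

(** * Schedules: a finite prefix followed by a round robin *)

Section Schedules.

Variables (V : finType) (M : Type).

Definition not_byz (e : event V M) : bool :=
  if e is EvByz _ _ then false else true.

Definition actor (e : event V M) : V :=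
  match e with EvStart w | EvDeliver _ w | EvByz w _ => w end.

Definition event_of (i : V + V * V) : event V M :=
  match i with inl v => EvStart M v | inr (u, v) => EvDeliver M u v end.

(** [v0] makes the enumeration non-empty, so the index is always in range and the default of [nth]
    is never returned. *)
Definition round_robin (v0 : V) (k : nat) : event V M :=
  event_of (nth (inl v0) (enum {: V + V * V}) (k %% #|{: V + V * V}|)).

Definition prefixed (p : seq (event V M)) (ev : nat -> event V M) (k : nat) :=
  if (k < size p)%N then nth (ev 0) p k else ev (k - size p)%N.

Lemma not_byz_round_robin (v0 : V) (k : nat) : not_byz (round_robin v0 k).
Proof. by rewrite /round_robin; case: nth => [|[]]. Qed.

Lemma prefixed_round_robin_recurrent v0 p i k :
  exists2 k', (k <= k')%N & prefixed p (round_robin v0) k' = event_of i.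
Proof.
set n := #|{: V + V * V}|.
have ltin : (index i (enum {: V + V * V}) < n)%N.
  by rewrite /n cardE index_mem mem_enum.
(* The occurrence of [i] in round [k] after the prefix; it comes late enough because [n] is
   positive. *)
exists (size p + (k * n + index i (enum {: V + V * V})))%N.
  apply: leq_trans (leq_addl _ _); apply: leq_trans (leq_addr _ _).
  by rewrite leq_pmulr //; apply: leq_ltn_trans ltin.
rewrite /prefixed ltnNge leq_addr /= addKn /round_robin modnMDl modn_small //.
by rewrite nth_index ?mem_enum.
Qed.

End Schedules.

(** * Executions: fair extensions and indistinguishability *)

Section Executions.

Variables (V : finType) (P : algorithm V) (adj : rel V).

Implicit Types (F A : {set V}) (x : V -> R) (ev : nat -> event V (Msg P)).
Implicit Types (c : config V (St P) (Msg P)).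

Lemma run_prefixed F x p ev :
  run P adj F x (prefixed p ev) (size p)
  = foldl (apply_event P adj F x) (init_config V (St P) (Msg P)) p.
Proof.
suff H k : (k <= size p)%N -> run P adj F x (prefixed p ev) k
    = foldl (apply_event P adj F x) (init_config V (St P) (Msg P)) (take k p).
  by rewrite H // take_size.
elim: k => [|k IH] lek; first by rewrite take0.
rewrite (take_nth (ev 0)) // -cats1 foldl_cat /= IH ?(ltnW lek) //.
by rewrite /prefixed lek.
Qed.

Lemma cstate_apply_event F x c e v :
  cstate c v <> None -> cstate (apply_event P adj F x c e) v <> None.
Proof.
case: c => st q /= Hv; case: e => [w|u w|u m] /=.
- case: (st w) => [//|]; case: ifP => // _; case: init => s ms /=.
  by rewrite /upd; case: ifP.
- case: ifP => // _; case: (st w) => // s; case: (q u w) => // m q1.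
  case: decide => //; case: step => s' ms /=.
  by rewrite /upd; case: ifP.
- by case: ifP.
Qed.

Lemma cstate_run F x ev v k k' :
  (k <= k')%N -> cstate (run P adj F x ev k) v <> None ->
  cstate (run P adj F x ev k') v <> None.
Proof.
move=> /subnKC <-; elim: (k' - k)%N => [|d IH] Hk; first by rewrite addn0.
by rewrite addnS /=; apply/cstate_apply_event/IH.
Qed.

Lemma bcast_neq_nil (q : V -> V -> seq (Msg P)) w ms u v :
  q u v <> [::] -> bcast adj q w ms u v <> [::].
Proof. by rewrite /bcast; case: ifP => // _; case: (q u v). Qed.

(** Broadcasts only append, so a link can be emptied only by its own delivery to a started receiver,
    which is exactly a witness for fairness. *)
Lemma cqueue_apply_event F x c e u v :
  cqueue c u v <> [::] ->
  cqueue (apply_event P adj F x c e) u v <> [::] \/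
  (e = EvDeliver (Msg P) u v /\ cstate c v <> None).
Proof.
case: c => st q /= Hq; case: e => [w|u' w|u' m] /=.
- left; case: (st w) => //; case: ifP => // _; case: init => s ms /=.
  exact: bcast_neq_nil.
- case: ifP => [_|]; last by left.
  case Est: (st w) => [s|]; last by left.
  case: (q u' w) => [|m q1]; first by left.
  case: decide; first by left.
  case: step => s' ms /=.
  have [/andP[/eqP -> /eqP ->]|ne] := boolP ((u == u') && (v == w)).
    by right; rewrite ?Est.
  by left; apply: bcast_neq_nil; rewrite (negbTE ne).
- by left; case: ifP => // _; apply: bcast_neq_nil.
Qed.

(** Any finite list of events thus extends to a fair execution, so the guarantees of a correct
    algorithm apply to whatever happens within the list. *)
Lemma prefixed_round_robin_fair F x v0 p :
  fair P adj F x (prefixed p (round_robin (Msg P) v0)).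
Proof.
set ev := prefixed _ _; have start v : v \notin F ->
    exists k, cstate (run P adj F x ev k) v <> None.
  move=> vF; have [k _ Ek] := prefixed_round_robin_recurrent v0 p (inl v) 0.
  exists k.+1; rewrite /= {2}/ev Ek /= vF.
  case Est: (cstate (run P adj F x ev k) v) => [s|]; first by rewrite Est.
  by case: (init P v (x v)) => s ms /=; rewrite /upd eqxx.
split=> // u v k vF adjuv.
have [k0 Hk0] := start v vF.
(* [k1] is a delivery time after both [k] and the start of [v]. Induction on [k1 - k]: the queue
   stays non-empty until [k1], or an earlier delivery on the link is the witness. *)
have [k1] := prefixed_round_robin_recurrent v0 p (inr (u, v)) (maxn k k0).
rewrite geq_max => /andP[lekk1 lek0k1] Ek1.
have {Hk0 lek0k1} Hk1 := cstate_run lek0k1 Hk0.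
move: lekk1 Ek1 Hk1 => /subnKC <-.
move: {k1 k0}(k1 - k)%N => d; elim: d k => [|d IH] k.
  by rewrite addn0 => Ek Hk Hq; exists k; split=> //; right.
rewrite addnS -addSn => Ek Hk Hq.
have [Hq'|[Ev Hs]] := @cqueue_apply_event F x _ (ev k) u v Hq.
  have [k' [lek' H']] := IH k.+1 Ek Hk Hq'.
  by exists k'; split=> //; apply: ltnW.
by exists k; split=> //; right.
Qed.

(** A faulty node can thus imitate the multi-message broadcast of one correct step. *)
Lemma foldl_byz F x w ms c : w \in F ->
  let c' := foldl (apply_event P adj F x) c [seq EvByz w m | m <- ms] in
  cstate c' = cstate c /\
  forall u v, cqueue c' u v = bcast adj (cqueue c) w ms u v.
Proof.
move=> wF; elim: ms c => [|m ms IH] c /=.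
  by split=> // u v; rewrite /bcast cats0; case: ifP.
rewrite wF; have [-> Hq] := IH (Config (cstate c) (bcast adj (cqueue c) w [:: m])).
split=> // u v; rewrite Hq /bcast /=.
by case: (_ && _); rewrite -?catA.
Qed.

(** All that the nodes of [A] can perceive: their states and their incoming links. Links leaving [A]
    may differ. *)
Definition same_view A c c' :=
  (forall v, v \in A -> cstate c v = cstate c' v) /\
  (forall u v, v \in A -> cqueue c u v = cqueue c' u v).

Lemma bcast_ext (q q' : V -> V -> seq (Msg P)) w ms u v :
  q u v = q' u v -> bcast adj q w ms u v = bcast adj q' w ms u v.
Proof. by rewrite /bcast => ->. Qed.

Lemma same_view_upd A st st' (q q' : V -> V -> seq (Msg P)) w s ms :
  same_view A (Config st q) (Config st' q') ->
  same_view A (Config (upd st w s) (bcast adj q w ms))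
              (Config (upd st' w s) (bcast adj q' w ms)).
Proof.
move=> [Hs Hq]; split=> [v vA|u v vA] /=.
  by rewrite /upd; case: ifP => // _; apply: Hs.
exact: bcast_ext (Hq u v vA).
Qed.

(** A correct step reads only the state, the input and one incoming link of its actor, and these
    agree on both sides. *)
Lemma apply_event_in F F' A x x' c c' e :
  [disjoint A & F] -> [disjoint A & F'] ->
  (forall v, v \in A -> x v = x' v) ->
  not_byz e -> actor e \in A ->
  same_view A c c' ->
  same_view A (apply_event P adj F x c e) (apply_event P adj F' x' c' e).
Proof.
move=> dF dF' xx'; case: c c' => [st q] [st' q'].
case: e => [w|u w|//] _ /= wA H; case: (H) => /= Hs Hq.
  rewrite (disjointFr dF wA) (disjointFr dF' wA) /= -(Hs w wA) -(xx' w wA).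
  case: (st w) => //; case: (init P w (x w)) => s ms; exact: same_view_upd.
rewrite (disjointFr dF wA) (disjointFr dF' wA) /= -(Hs w wA) -(Hq u w wA).
case: ifP => // _; case: (st w) => // s; case: (q u w) => // m q1.
case: decide => //; case: step => s' ms; apply: same_view_upd; split=> //= a b bA.
by rewrite (Hq a b bA).
Qed.

(** Seen from [A], a step elsewhere is at most a broadcast: the state it changes and the link it
    consumes from both belong to a node outside [A]. *)
Lemma apply_event_out F A x c e :
  not_byz e -> actor e \notin A ->
  same_view A c (apply_event P adj F x c e) \/
  actor e \notin F /\
  exists ms, same_view A (apply_event P adj F x c e)
                         (Config (cstate c) (bcast adj (cqueue c) (actor e) ms)).
Proof.
case: c => st q; case: e => [w|u w|//] _ /= wA.
  case: (st w) => [_|]; first by left.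
  case: ifP => wF; last by left.
  case: init => s ms; right; split=> //; exists ms; split=> //= v vA.
  by rewrite /upd; case: eqP => // ?; subst v; rewrite vA in wA.
case: ifP => [/andP[wF _]|]; last by left.
case: (st w) => [s|]; last by left.
case: (q u w) => [|m q1]; first by left.
case: decide; first by left.
case: step => s' ms; right; split=> //; exists ms; split=> /= [v vA|a b bA].
  by rewrite /upd; case: eqP => // ?; subst v; rewrite vA in wA.
apply: bcast_ext; case: (b =P w) => [?|_]; last by rewrite andbF.
by subst b; rewrite bA in wA.
Qed.

Lemma same_view_sym A c c' : same_view A c c' -> same_view A c' c.
Proof. by move=> [Hs Hq]; split=> *; rewrite ?Hs ?Hq. Qed.

Lemma same_view_trans A c1 c2 c3 :
  same_view A c1 c2 -> same_view A c2 c3 -> same_view A c1 c3.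
Proof.
by move=> [Hs Hq] [Hs' Hq']; split=> *; rewrite ?Hs ?Hq ?Hs' ?Hq'.
Qed.

(* In p the nodes of F' replay, as Byzantine nodes, the broadcasts they make as
   correct nodes in ev, and no node outside A and F' ever starts. *)
Lemma simulation F F' A x x' ev k :
  [disjoint A & F] -> [disjoint A & F'] ->
  (forall u v, v \in A -> adj u v -> [|| u \in A, u \in F | u \in F']) ->
  (forall v, v \in A -> x v = x' v) ->
  (forall i, not_byz (ev i)) ->
  exists p, same_view A (run P adj F x ev k)
    (foldl (apply_event P adj F' x') (init_config V (St P) (Msg P)) p).
Proof.
move=> dF dF' nbrA xx' nbyz; elim: k => [|k [p IH]]; first by exists [::].
set c := run P adj F x ev k in IH; set c' := foldl _ _ _ in IH.
pose e := ev k; have be : not_byz e := nbyz k.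
pose w := actor e; have [wA|wA] := boolP (w \in A).
  exists (rcons p e); rewrite -cats1 foldl_cat /= -/c -/c' -/e.
  exact: apply_event_in.
have [same|[wF [ms Hms]]] := apply_event_out F x c be wA.
  by exists p => /=; apply: same_view_trans (same_view_sym same) IH.
have [wF'|wF'] := boolP (w \in F').
  exists (p ++ [seq EvByz w m | m <- ms]); rewrite foldl_cat /= -/c -/c'.
  have [Es Eq] := foldl_byz x' ms c' wF'.
  apply: same_view_trans Hms _; case: IH => Hs Hq.
  split=> [v vA|u v vA] /=; first by rewrite Es Hs.
  by rewrite Eq; apply: bcast_ext; apply: Hq.
(* Here [w] lies outside [A], [F] and [F'], so it has no neighbour in [A] and its broadcast is
   invisible there: the step is skipped. *)
exists p => /=; apply: same_view_trans Hms (same_view_trans _ IH).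
split=> //= u v vA; rewrite /bcast; case: ifP => // /andP[_ adjwv].
by have := nbrA w v vA adjwv; rewrite (negbTE wA) (negbTE wF) (negbTE wF').
Qed.

(** The simulating prefix, run with all inputs [z] and faulty set [F'], shows [a] the same state.
    Its fair extension obeys validity, and the hull of constant inputs is [z] alone. *)
Lemma output_forced f L U eps F F' A x z ev k a y :
  solves_approx_BC adj f L U eps P ->
  (#|F'| <= f)%N -> (L <= z <= U)%R ->
  [disjoint A & F] -> [disjoint A & F'] ->
  (forall u v, v \in A -> adj u v -> [|| u \in A, u \in F | u \in F']) ->
  (forall v, v \in A -> x v = z) ->
  (forall i, not_byz (ev i)) ->
  a \in A -> output P (run P adj F x ev k) a = Some y -> y = z.
Proof.
move=> solves cF' zLU dF dF' nbrA xz nbyz aA.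
have [p [Hs _]] := @simulation F F' A x (fun _ => z) ev k dF dF' nbrA xz nbyz.
rewrite /output (Hs a aA) -(run_prefixed F' _ p (round_robin (Msg P) a)) => Hy.
have [_ _ valid] := solves F' (fun _ => z) _ cF' (fun _ => zLU)
  (prefixed_round_robin_fair F' (fun _ => z) a p).
apply: (@in_hull_const V F'); apply: (valid a (size p)) => //.
by rewrite (disjointFr dF' aA).
Qed.

End Executions.

Theorem theorem2 (V : finType) (adj : rel V)
    (adj_sym : symmetric adj) (adj_irr : irreflexive adj)
    (f : nat) (hf : (0 < f < #|V|)%N)
    (L U eps : R) (heps : (0 < eps)%R) (hLU : (eps < U - L)%R) :
  (exists P : algorithm V, solves_approx_BC adj f L U eps P) ->
  k_connected adj (2 * f + 1).
Proof.
move=> [P solves] [C [A [B [cC [A0 [B0 [dAB [dAC [dBC [cover noedge]]]]]]]]]].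
have [|C1 [C2 [cC1 cC2 dC EC]]] := @split_card_leq V C f.
  by move: cC; rewrite addn1 ltnS.
have {dAC} [dA1 dA2] : [disjoint A & C1] /\ [disjoint A & C2].
  by split; apply: disjointWr dAC; rewrite -EC ?subsetUl ?subsetUr.
have {dBC} [dB1 dB2] : [disjoint B & C1] /\ [disjoint B & C2].
  by split; apply: disjointWr dBC; rewrite -EC ?subsetUl ?subsetUr.
have inV u : [|| u \in A, u \in B, u \in C1 | u \in C2].
  by have := in_setT u; rewrite -cover -EC !inE -!orbA.
have [/set0Pn[a aA] /set0Pn[b bB]] := (A0, B0).
pose x v := if v \in A then L else U.
(* With no Byzantine event in the schedule, the faulty nodes [C1] stay silent: they have crashed. *)
pose ev := prefixed [::] (round_robin (Msg P) a).
have nbyz i : not_byz (ev i).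
  by rewrite /ev /prefixed /=; apply: not_byz_round_robin.
have xLU v : (L <= x v <= U)%R by rewrite /x; case: ifP => _; lra.
have [term agree _] := solves C1 x ev cC1 xLU (prefixed_round_robin_fair _ _ _ _ _).
have aC1 : a \notin C1 by rewrite (disjointFr dA1 aA).
have bC1 : b \notin C1 by rewrite (disjointFr dB1 bB).
have [k [y Hy]] := term a aC1; have [k' [y' Hy']] := term b bC1.
(* Used with [F := C1] and [F' := C2]: every neighbour of [A] outside [A] lies in one of them, since
   no edge joins [A] to [B]. *)
have yL : y = L.
  apply: (output_forced solves cC2 _ dA1 dA2 _ _ nbyz aA Hy) => [|u v vA auv|v vA].
  - lra.
  - have := inV u; case: (boolP (u \in B)) => //= uB _.
    by have := noedge v u vA uB; rewrite adj_sym auv.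
  - by rewrite /x vA.
have yU : y' = U.
  apply: (output_forced solves cC2 _ dB1 dB2 _ _ nbyz bB Hy') => [|u v vB auv|v vB].
  - lra.
  - have := inV u; case: (boolP (u \in A)) => //= uA _.
    by have := noedge u v uA vB; rewrite auv.
  - by rewrite /x (disjointFl dAB vB).
have := agree a b k k' y y' aC1 bC1 Hy Hy'.
(* Agreement would give [U - L <= eps], against [hLU]. *)
rewrite yL yU Rabs_minus_sym Rabs_pos_eq; lra.
Qed.
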